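(* Let $n\ge3$ be an integer. Let $\overline{H}\colon \mathbb{P}^2(\mathbb{Q}) \to \mathbb{R}_{>0}$ be a height relative to $$\mathcal{O}_{\mathbb{P}^2_{\mathbb{Q}}}(-n-1) \cong \mathcal{O}_{P_n}(-1) \otimes \omega_{P_n}.$$ There exist positive constants $c_1, c_2$ such that for every $x \in \mathbb{P}^2(\mathbb{Q}) \setminus \{a=c=0\}$ we have $$c_1 \overline{H}(x) \le \mathfrak{c}_x \le c_2 \overline{H}(x).$$
   Context: $(a:c:z)$ are the homogeneous coordinates on $\mathbb{P}^2_{\mathbb{Q}}$. $P_n$ denotes $\mathbb{P}^2_{\mathbb{Q}}$ polarized by $\mathcal{O}_{P_n}(1)\cong\mathcal{O}_{\mathbb{P}^2_{\mathbb{Q}}}(n-2)$, and $\omega_{P_n}$ is its canonical bundle. A height relative to $\mathcal{O}_{\mathbb{P}^2_{\mathbb{Q}}}(r)$, $r\in\mathbb{Z}$, is a (multiplicative Weil) height function, i.e. it equals, up to a factor bounded above and below by positive constants, the function $(a:c:z)\mapsto\max\{|a|,|c|,|z|\}^r$ for coprime integral coordinates $a,c,z$. For $x\in\mathbb{P}^2(\mathbb{Q})\setminus\{a=c=0\}$ with coprime integral coordinates $(a:c:z)$, put $\mathfrak{c}_x=\frac12\cdot\frac1{\zeta(2)}\cdot\omega_{\infty,x}$ with $$\omega_{\infty,x} = \iint_{\substack{|a^{n}w|,|c^{n}w|,|z^{n}w| \le 1\\ |b|,|(bc+z^{n+1}w)/a| \le 1}} \frac{1}{|a|} \,\mathrm{d}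 b\,\mathrm{d} w \quad\text{for } a\neq 0,$$ $$\omega_{\infty,x} = \iint_{\substack{|a^{n}w|,|c^{n}w|,|z^{n}w| \le 1\\ |(ad-z^{n+1}w)/c|,|d| \le 1}} \frac{1}{|c|} \,\mathrm{d} d\,\mathrm{d} w \quad\text{for } c\neq 0$$ (the two expressions agree if $ac\ne0$). *)

(* Defs.v *)
From HB Require Import structures.
From mathcomp Require Import all_boot all_order all_algebra.
From mathcomp Require Import all_classical all_reals all_analysis.

Set Implicit Arguments.
Unset Strict Implicit.
Unset Printing Implicit Defensive.

Import Order.TTheory GRing.Theory Num.Theory.
Import numFieldNormedType.Exports.

Local Open Scope classical_set_scope.
Local Open Scope ring_scope.

(* Rational points of the projective plane: lines through the origin in Q^3. *)
Definition P2Q := {U : {vspace 'rV[rat]_3} | \dim U == 1%N}.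

Definition coord_vec (a c z : int) : 'rV[rat]_3 :=
  \row_(i < 3) ([:: a; c; z]`_i)%:~R.

(* The triple is determined by x up to a common sign. *)
Definition coprime_coords (x : P2Q) (a c z : int) : Prop :=
  gcdz a (gcdz c z) = 1 /\ val x = <[coord_vec a c z]>%VS.

Definition max_abs (a c z : int) : int := Num.max `|a| (Num.max `|c| `|z|).

(* Multiplicative Weil heights relative to O(r), r an integer. *)
Definition is_height (R : realType) (r : int) (H : P2Q -> R) : Prop :=
  (forall x, 0 < H x) /\
  exists k1 k2 : R, [/\ 0 < k1, 0 < k2 &
    forall x a c z, coprime_coords x a c z ->
      k1 * (max_abs a c z)%:~R ^ r <= H x <= k2 * (max_abs a c z)%:~R ^ r].

Definition zeta2 (R : realType) : R := limn (series (riemannR (2 : R))).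

Definition plane_measure (R : realType) :=
  (@lebesgue_measure R \x @lebesgue_measure R)%E.

(* Chart a != 0; points of the plane are p = (b, w). *)
Definition omega_a (R : realType) (n : nat) (a c z : R) : R :=
  \int[@plane_measure R]_(p in [set p : R * R |
      [/\ `|a ^+ n * p.2| <= 1, `|c ^+ n * p.2| <= 1, `|z ^+ n * p.2| <= 1,
          `|p.1| <= 1 & `|(p.1 * c + z ^+ n.+1 * p.2) / a| <= 1]])
    (1 / `|a|).

(* Chart c != 0; points of the plane are p = (d, w). *)
Definition omega_c (R : realType) (n : nat) (a c z : R) : R :=
  \int[@plane_measure R]_(p in [set p : R * R |
      [/\ `|a ^+ n * p.2| <= 1, `|c ^+ n * p.2| <= 1, `|z ^+ n * p.2| <= 1,
          `|(a * p.1 - z ^+ n.+1 * p.2) / c| <= 1 & `|p.1| <= 1]])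
    (1 / `|c|).

(* The two charts give the same value when a and c are both nonzero; the value
   for a = c = 0 is irrelevant. *)
Definition omega_infty (R : realType) (n : nat) (a c z : R) : R :=
  if a != 0 then omega_a n a c z else omega_c n a c z.

(* The constant attached to the point with coprime coordinates (a : c : z);
   it is invariant under (a, c, z) -> (- a, - c, - z). *)
Definition frak_c (R : realType) (n : nat) (a c z : int) : R :=
  1 / 2 * (1 / zeta2 R) * omega_infty n (a%:~R : R) (c%:~R : R) (z%:~R : R).

(* Main.v *)
Require Import Defs.
From HB Require Import structures.
From mathcomp Require Import all_boot all_order all_algebra.
From mathcomp Require Import all_classical all_reals all_analysis.
From mathcomp Require Import measurable_realfun.
From mathcomp Require Import ring lra.

Import Order.TTheory GRing.Theory Num.Theory.
Import numFieldNormedType.Exports.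

(** Let [M] be the maximum of [|a|], [|c|], [|z|]. By definition of a height,
    [H x] is [M^-(n+1)] up to bounded factors, and [frak_c] is the integral
    [omega_infty] times the constant [1 / (2 zeta(2))], which is positive
    ([zeta2_gt0]). So everything reduces to
      [M^-(n+1) <= omega_infty <= 4 M^-(n+1)]
    ([omega_infty_bounds]).

    The integrand is the constant [1 / |a|], hence the integral is the area of
    the region [|w| <= M^-n], [|b| <= 1], [|b c + s w| <= |a|], divided by
    [|a|], where [s] is [z^(n+1)] up to sign; exchanging [a] and [c] gives the
    other chart. The region is compared with parallelograms
    [|x| <= r, |y - t x| <= k], of area [4 r k] for every slope [t]. It lies in
    one of area [4 |a| M^-(n+1)], obtained by dropping one of the three
    conditions according to which coordinate has absolute value [M]
    ([chart_region_measure_le]). It contains one of area [|a| M^-(n+1)], a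
    rectangle if [|c| <= |a|] and a thin neighbourhood of a piece of the line
    [b c + s w = 0] otherwise ([chart_region_measure_ge]). *)

Local Open Scope classical_set_scope.
Local Open Scope ring_scope.

(** * Areas of parallelograms *)

Lemma measurable_affine_strip {R : realType} (t v k : R) :
  measurable [set p : R * R | `|t * p.1 + v * p.2| <= k].
Proof.
have mf : measurable_fun setT (fun p : R * R => `|t * p.1 + v * p.2|).
  apply: measurableT_comp => //; apply: measurable_funD;
    by apply: measurable_funM.
have := measurable_fun_le measurableT mf (measurable_cst k).
by rewrite setTI.
Qed.

Lemma measurable_parallelogram_over_fst {R : realType} (t r k : R) :
  measurable [set p : R * R | `|p.1| <= r /\ `|p.2 - t * p.1| <= k].
Proof.
rewrite (_ : [set _ | _] = [set p | `|1 * p.1 + 0 * p.2| <= r] `&`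
  [set p : R * R | `|(- t) * p.1 + 1 * p.2| <= k]).
  by apply: measurableI; exact: measurable_affine_strip.
by apply/seteqP; split => x /=; rewrite !mul0r addr0 !mul1r mulNr addrC.
Qed.

Lemma measurable_parallelogram_over_snd {R : realType} (t r k : R) :
  measurable [set p : R * R | `|p.2| <= r /\ `|p.1 - t * p.2| <= k].
Proof.
rewrite (_ : [set _ | _] = [set p | `|0 * p.1 + 1 * p.2| <= r] `&`
  [set p : R * R | `|1 * p.1 + (- t) * p.2| <= k]).
  by apply: measurableI; exact: measurable_affine_strip.
by apply/seteqP; split => x /=; rewrite !mul0r add0r !mul1r mulNr.
Qed.

Lemma lebesgue_measure_interval {R : realType} (m : R) {k : R} : 0 <= k ->
  lebesgue_measure [set y : R | `|y - m| <= k] = (k *+ 2)%:E.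
Proof.
move=> k0.
have -> : [set y : R | `|y - m| <= k] = `[m - k, m + k]%classic.
  by apply/seteqP; split=> y /=; rewrite in_itv /= ler_distl.
rewrite lebesgue_measure_itv /= lte_fin.
case: ltP => h; first by rewrite -EFinD; congr (_%:E); rewrite mulr2n; ring.
by congr (_%:E); rewrite mulr2n; lra.
Qed.

(** Shearing preserves area: every vertical section over [|x| <= r] is an
    interval of length [2 k], wherever its centre [t * x] lies. *)
Lemma measure_parallelogram_over_fst {R : realType} (t : R) {r k : R} :
  0 <= r -> 0 <= k ->
  plane_measure [set p | `|p.1| <= r /\ `|p.2 - t * p.1| <= k]
  = (4 * r * k)%:E.
Proof.
move=> r0 k0.
rewrite /plane_measure /= /product_measure1 /=.
set D := [set x : R | `|x| <= r].
have mD : measurable D.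
  rewrite /D (_ : [set _ | _] = `[- r, r]%classic) //.
  by apply/seteqP; split => x /=; rewrite in_itv /= ler_norml.
transitivity (\int[lebesgue_measure]_(x in D) cst (k *+ 2)%:E x)%E.
  rewrite [RHS]integral_mkcond; apply: eq_integral => x _ /=.
  rewrite patchE; case: ifPn => [|]; rewrite ?notin_setE ?inE /= => xr.
    rewrite -(lebesgue_measure_interval (t * x) k0).
    congr (lebesgue_measure _); apply/seteqP.
    by split=> y /=; rewrite /xsection /= inE /=; tauto.
  rewrite (_ : xsection _ _ = set0) ?measure0 //.
  by apply/seteqP; split=> y //=; rewrite /xsection /= inE /=; tauto.
rewrite integral_cst //.
have := lebesgue_measure_interval 0 r0.
under eq_set do rewrite subr0.
rewrite -/D.
move=> h; apply: etrans (congr1 (mule _) h) _; rewrite -EFinM; congr (_%:E).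
by rewrite !mulr2n; ring.
Qed.

(** Both iterated integrals define measures with the right value on rectangles,
    so they agree; swapping the coordinates turns one into the other. *)
Lemma plane_measure_swap {R : realType} (A : set (R * R)) :
  measurable A -> plane_measure A = plane_measure [set p | A (p.2, p.1)].
Proof.
move=> mA.
rewrite {1}/plane_measure
  (product_measure_unique (m' := (lebesgue_measure \x^ lebesgue_measure)%E)) //.
by move=> B C mB mC; exact: product_measure2E.
Qed.

Lemma measure_parallelogram_over_snd {R : realType} (t : R) {r k : R} :
  0 <= r -> 0 <= k ->
  plane_measure [set p | `|p.2| <= r /\ `|p.1 - t * p.2| <= k]
  = (4 * r * k)%:E.
Proof.
move=> r0 k0; rewrite -(measure_parallelogram_over_fst t r0 k0).
by rewrite plane_measure_swap //; exact: measurable_parallelogram_over_snd.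
Qed.

(** * The region of integration in a chart *)

Definition sup_norm {R : realType} (a c z : R) : R :=
  Num.max `|a| (Num.max `|c| `|z|).

Lemma sup_norm_cases {R : realType} (a c z : R) :
  [\/ sup_norm a c z = `|a|, sup_norm a c z = `|c| | sup_norm a c z = `|z|].
Proof.
rewrite /sup_norm.
case: (leP `|c| `|z|) => _;
  [case: (leP `|a| `|z|) | case: (leP `|a| `|c|)] => _.
- by constructor 3.
- by constructor 1.
- by constructor 2.
- by constructor 1.
Qed.

(** The two charts are treated together: chart [a != 0] is the case
    [s = z ^+ n.+1], and chart [c != 0] is the case [s = - z ^+ n.+1] with [a]
    and [c] exchanged. Only the absolute value of [s] matters for the area. *)
Definition chart_region {R : realType} (n : nat) (a c z s : R) : set (R * R) :=
  [set p | [/\ `|a ^+ n * p.2| <= 1, `|c ^+ n * p.2| <= 1,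
    `|z ^+ n * p.2| <= 1, `|p.1| <= 1 & `|(p.1 * c + s * p.2) / a| <= 1]].

Lemma chart_regionE {R : realType} (n : nat) (a c z s : R) : a != 0 ->
  chart_region n a c z s =
  [set p | [/\ sup_norm a c z ^+ n * `|p.2| <= 1, `|p.1| <= 1
    & `|p.1 * c + s * p.2| <= `|a|]].
Proof.
move=> a0; apply/seteqP; split=> -[b w] /=;
  rewrite /chart_region /= !normrM !normrX normfV ler_pdivrMr
    ?normr_gt0 // mul1r.
  move=> [aw cw zw b1 bw]; split=> //.
  by have [->|->|->] := sup_norm_cases a c z; rewrite ?normr_id.
have pow_le x : `|x| <= sup_norm a c z ->
    sup_norm a c z ^+ n * `|w| <= 1 -> `|x| ^+ n * `|w| <= 1.
  by move=> xM; apply: le_trans; rewrite ler_wpM2r // lerXn2r // ?nnegrE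
    // (le_trans _ xM).
by move=> [Mw b1 bw]; split=> //; apply: pow_le => //;
  rewrite /sup_norm !le_max lexx ?orbT.
Qed.

Lemma measurable_chart_region {R : realType} (n : nat) (a c z s : R) :
  a != 0 -> measurable (chart_region n a c z s).
Proof.
move=> a0; rewrite chart_regionE //.
set M := sup_norm a c z.
have M0 : 0 <= M ^+ n by rewrite exprn_ge0 // /M /sup_norm le_max normr_ge0.
rewrite (_ : [set _ | _] = [set p | `|0 * p.1 + M ^+ n * p.2| <= 1] `&`
  ([set p | `|1 * p.1 + 0 * p.2| <= 1] `&`
   [set p : R * R | `|c * p.1 + s * p.2| <= `|a|])).
  by do 2?apply: measurableI; exact: measurable_affine_strip.
apply/seteqP; split=> -[b w] /=;
  rewrite !mul0r add0r addr0 mul1r normrM (ger0_norm M0) (mulrC c);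
  by move=> [? []] // [].
Qed.

(** Besides [|b| <= 1] and [|w| <= M^-n] there is the strip
    [|b c + s w| <= |a|]. Two of the three conditions already cut out a small
    enough parallelogram, and which two depends on the coordinate realizing the
    maximum [M]: the rectangle if it is [a], the strip together with the bound
    on [w] if it is [c], the strip together with the bound on [b] if it is [z].
    In the last two cases the strip is narrow in the remaining direction, of
    half-width [|a| / |c|] and [|a| / |s|]. *)
Lemma chart_region_measure_le {R : realType} (n : nat) (a c z s : R) :
  a != 0 -> `|s| = `|z| ^+ n.+1 ->
  (plane_measure (chart_region n a c z s)
   <= (4 * (`|a| / sup_norm a c z ^+ n.+1))%:E)%E.
Proof.
move=> a0 sz.
have mA := @measurable_chart_region R n a c z s a0.
have a_gt0 : 0 < `|a| by rewrite normr_gt0.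
move: mA; rewrite chart_regionE //; set M := sup_norm a c z => mA.
have M0 : 0 < M by rewrite /M /sup_norm lt_max a_gt0.
have Mn0 : 0 < M ^+ n by rewrite exprn_gt0.
have w_le (w : R) : M ^+ n * `|w| <= 1 -> `|w| <= (M ^+ n)^-1.
  by move=> h; rewrite -[leRHS]mul1r ler_pdivlMr // mulrC.
have [Ma|Mc|Mz] : [\/ M = `|a|, M = `|c| | M = `|z|].
- exact: sup_norm_cases.
- rewrite (_ : 4 * _ = 4 * 1 * (M ^+ n)^-1); last first.
    by rewrite -Ma exprS; field; rewrite !gt_eqF.
  rewrite -(measure_parallelogram_over_fst 0) ?invr_ge0 ?(ltW Mn0) //.
  apply: le_measure; rewrite ?inE //.
    exact: measurable_parallelogram_over_fst.
  by move=> [b w] /= [Mw b1 _]; rewrite mul0r subr0; split=> //; exact: w_le.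
- have c_neq0 : c != 0 by rewrite -normr_gt0 -Mc.
  rewrite (_ : 4 * _ = 4 * (M ^+ n)^-1 * (`|a| / M)); last first.
    by rewrite exprS; field; rewrite !gt_eqF.
  rewrite -(measure_parallelogram_over_snd (- (s / c)));
    rewrite ?divr_ge0 ?invr_ge0 ?(ltW M0) ?(ltW Mn0) //.
  apply: le_measure; rewrite ?inE //.
    exact: measurable_parallelogram_over_snd.
  move=> [b w] /= [Mw b1 h]; split; first exact: w_le.
  rewrite (_ : b - _ = (b * c + s * w) / c); last by field.
  by rewrite normrM normfV -Mc ler_pM2r ?invr_gt0.
- have sM : `|s| = M ^+ n.+1 by rewrite sz -Mz.
  have s_gt0 : 0 < `|s| by rewrite sM exprn_gt0.
  have s_neq0 : s != 0 by rewrite -normr_gt0.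
  rewrite (_ : 4 * _ = 4 * 1 * (`|a| / `|s|)); last by rewrite sM mulr1.
  rewrite -(measure_parallelogram_over_fst (- (c / s))) ?divr_ge0 //.
  apply: le_measure; rewrite ?inE //.
    exact: measurable_parallelogram_over_fst.
  move=> [b w] /= [Mw b1 h]; split=> //.
  rewrite (_ : w - _ = (b * c + s * w) / s); last by field.
  by rewrite normrM normfV ler_pM2r ?invr_gt0.
Qed.

(** The region contains a parallelogram of comparable size. If [|c| <= |a|],
    each of the two summands of [b c + s w] may take up to half of the allowance
    [|a|], so a rectangle fits. If [|a| < |c|], the strip is thin in the
    direction of [b]; its centre line [b = - s w / c] stays within
    [|b| <= 1 / 2] as long as [|w|] is at most [|c| / (2 M^(n+1))], and the
    half-width [|a| / (2 |c|)] is below [1 / 2]. *)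
Lemma chart_region_measure_ge {R : realType} (n : nat) (a c z s : R) :
  a != 0 -> `|s| = `|z| ^+ n.+1 ->
  ((`|a| / sup_norm a c z ^+ n.+1)%:E
   <= plane_measure (chart_region n a c z s))%E.
Proof.
move=> a0 sz.
have mA := @measurable_chart_region R n a c z s a0.
have a_gt0 : 0 < `|a| by rewrite normr_gt0.
move: mA; rewrite chart_regionE //; set M := sup_norm a c z => mA.
have M0 : 0 < M by rewrite /M /sup_norm lt_max a_gt0.
have Mn0 : 0 < M ^+ n by rewrite exprn_gt0.
have MS0 : 0 < M ^+ n.+1 by rewrite exprn_gt0.
have sM : `|s| <= M ^+ n.+1.
  rewrite sz lerXn2r ?nnegrE ?(ltW M0) //.
  by rewrite /M /sup_norm !le_max lexx !orbT.
(* [m] will be the larger of [|a|] and [|c|]; the factor 1 / 2 leaves room in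
   the strip for the contribution of [b]. *)
have w_le (m w : R) : 0 < m <= M -> `|w| <= m / (2 * M ^+ n.+1) ->
    M ^+ n * `|w| <= 1 /\ `|s * w| <= m / 2.
  move=> /andP[m0 mM] wm; split.
    apply: (@le_trans _ _ (M ^+ n * (m / (2 * M ^+ n.+1)))).
      by rewrite ler_pM2l.
    rewrite (_ : _ * _ = m / (2 * M)); last first.
      by rewrite exprS; field; rewrite !gt_eqF.
    by rewrite ler_pdivrMr ?mulr_gt0 //; move: mM; lra.
  rewrite normrM (_ : m / 2 = M ^+ n.+1 * (m / (2 * M ^+ n.+1))); last first.
    by field; rewrite !gt_eqF.
  by rewrite ler_pM.
have [ca|ac] := leP `|c| `|a|.
- rewrite (_ : `|a| / _ = 4 * (1 / 2) * (`|a| / (2 * M ^+ n.+1))); last first.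
    by field; rewrite !gt_eqF.
  rewrite -(measure_parallelogram_over_fst 0) ?divr_ge0 ?mulr_ge0 ?(ltW MS0) //.
  apply: le_measure; rewrite ?inE //.
    exact: measurable_parallelogram_over_fst.
  move=> [b w] /= [b1]; rewrite mul0r subr0 => wm.
  have [|Mw sw] := w_le _ _ _ wm.
    by rewrite a_gt0 /M /sup_norm le_max lexx.
  split=> //; first by move: b1; lra.
  apply: le_trans (ler_normD _ _) _.
  have : `|b * c| <= 1 / 2 * `|a| by rewrite normrM ler_pM.
  by move: sw; lra.
- have c_gt0 : 0 < `|c| by exact: lt_trans ac.
  have c_neq0 : c != 0 by rewrite -normr_gt0.
  rewrite (_ : `|a| / _
    = 4 * (`|c| / (2 * M ^+ n.+1)) * (`|a| / (2 * `|c|))); last first.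
    by field; rewrite !gt_eqF.
  rewrite -(measure_parallelogram_over_snd (- (s / c)));
    rewrite ?divr_ge0 ?mulr_ge0 ?(ltW MS0) //.
  apply: le_measure; rewrite ?inE //.
    exact: measurable_parallelogram_over_snd.
  move=> [b w] /= [wm].
  rewrite (_ : b - _ = (b * c + s * w) / c); last by field.
  rewrite normrM normfV ler_pdivrMr //.
  rewrite (_ : `|a| / (2 * `|c|) * `|c| = `|a| / 2); last first.
    by field; rewrite gt_eqF.
  move=> h.
  have [|Mw sw] := w_le _ _ _ wm.
    by rewrite c_gt0 /M /sup_norm !le_max lexx orbT.
  split=> //; last by move: h; lra.
  rewrite -(ler_pM2r c_gt0) mul1r -normrM.
  rewrite (_ : b * c = (b * c + s * w) - s * w); last by rewrite addrK.
  by apply: le_trans (ler_normB _ _) _; move: h sw ac; lra.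
Qed.

Lemma integral_chart_region_bounds {R : realType} (n : nat) (a c z s : R) :
  a != 0 -> `|s| = `|z| ^+ n.+1 ->
  (sup_norm a c z ^+ n.+1)^-1
    <= \int[@plane_measure R]_(p in chart_region n a c z s) (1 / `|a|)
    <= 4 * (sup_norm a c z ^+ n.+1)^-1.
Proof.
move=> a0 sz.
have le_mu := @chart_region_measure_le R n a c z s a0 sz.
have ge_mu := @chart_region_measure_ge R n a c z s a0 sz.
have a_gt0 : 0 < `|a| by rewrite normr_gt0.
rewrite Rintegral_cst; last exact: measurable_chart_region.
rewrite -[X in fine X]/(plane_measure (chart_region n a c z s)).
move: le_mu ge_mu; case: (plane_measure _) => [m | |] //=.
rewrite !lee_fin => le_mu ge_mu.
rewrite mul1r mulrC ler_pdivlMr // ler_pdivrMr // [X in X <= _]mulrC ge_mu /=.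
by rewrite -mulrA [_^-1 * _]mulrC.
Qed.

(** These bounds hold for all real coordinates: they are compatible with
    scaling, both sides being homogeneous of degree [- (n + 1)]. *)
Lemma omega_infty_bounds {R : realType} (n : nat) (a c z : R) :
  ~ (a = 0 /\ c = 0) ->
  (sup_norm a c z ^+ n.+1)^-1 <= omega_infty n a c z
    <= 4 * (sup_norm a c z ^+ n.+1)^-1.
Proof.
move=> ac0; rewrite /omega_infty; case: ifPn => [a0|].
  by apply: integral_chart_region_bounds => //; rewrite normrX.
rewrite negbK => /eqP a0.
have c0 : c != 0 by apply/eqP => c0; exact: ac0.
have -> : sup_norm a c z = sup_norm c a z by rewrite /sup_norm maxCA.
rewrite /omega_c (_ : [set _ | _] = chart_region n c a z (- z ^+ n.+1)).
  by apply: integral_chart_region_bounds => //; rewrite normrN normrX.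
by apply/seteqP; split => -[d w] /=;
  rewrite /chart_region /= (mulrC d) mulNr => -[].
Qed.

(** * Positivity of zeta(2) and the theorem *)

(** The limit of the partial sums is a junk value unless they converge, so
    convergence has to be established: [1 / m^2 <= 1 / (m - 1) - 1 / m]
    telescopes, and bounds the partial sums by 2. *)
Lemma zeta2_gt0 {R : realType} : 0 < zeta2 R.
Proof.
set u := series (riemannR (2 : R)).
have uS m : u m.+1 = u m + (m.+1%:R ^+ 2)^-1.
  by rewrite /u /series /= big_nat_recr //= /riemannR powR_mulrn.
have u_nd : {homo u : n m / (n <= m)%N >-> n <= m}.
  by apply/nondecreasing_seqP => m; rewrite uS lerDl invr_ge0 exprn_ge0.
have ub m : u m.+1 <= 2 - m.+1%:R^-1.
  elim: m => [|m ih].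
    by rewrite uS /u /series /= big_geq // expr1n invr1; lra.
  rewrite uS.
  have m0 : 0 < m.+1%:R :> R by [].
  have m1 : m.+2%:R = m.+1%:R + 1 :> R by rewrite [in LHS]mulrS addrC.
  have : (m.+2%:R ^+ 2)^-1 <= m.+1%:R^-1 - m.+2%:R^-1 :> R.
    have -> : m.+1%:R^-1 - m.+2%:R^-1 = (m.+1%:R * m.+2%:R)^-1 :> R.
      by rewrite m1; field; lra.
    rewrite lef_pV2 ?posrE ?mulr_gt0 ?exprn_gt0 // expr2 ler_pM2r //.
    by rewrite ler_nat.
  by move=> h; apply: le_trans (lerD ih h) _; rewrite addrA subrK.
have cu : cvgn u.
  apply: nondecreasing_is_cvgn => //; exists 2 => _ [m _ <-].
  apply: le_trans (u_nd m m.+1 (leqnSn m)) _; apply: le_trans (ub m) _.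
  by rewrite gerBl invr_ge0.
apply: lt_le_trans (nondecreasing_cvgn_le u_nd cu 1).
by rewrite uS /u /series /= big_geq // add0r invr_gt0 exprn_gt0.
Qed.

Lemma intr_max {R : numDomainType} (i j : int) :
  (Num.max i j)%:~R = Num.max i%:~R j%:~R :> R.
Proof. by rewrite !maxEle ler_int; case: ifP. Qed.

Theorem theorem1p4 (R : realType) (n : nat) (hn : (3 <= n)%N)
    (H : P2Q -> R) (hH : is_height (- n%:Z - 1) H) :
  exists c1 c2 : R, [/\ 0 < c1, 0 < c2 &
    forall (x : P2Q) (a c z : int), coprime_coords x a c z ->
      ~ (a = 0 /\ c = 0) ->
      c1 * H x <= frak_c R n a c z <= c2 * H x].
Proof.
have z0 := @zeta2_gt0 R.
case: hH => H0 [k1 [k2 [k1_gt0 k2_gt0 Hk]]].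
set t : R := 1 / 2 * (1 / zeta2 R).
have t0 : 0 < t by rewrite /t mulr_gt0 // divr_gt0.
exists (t / k2), (4 * t / k1); split.
- exact: divr_gt0.
- by apply: divr_gt0 => //; exact: mulr_gt0.
move=> x a c z xacz ac0.
have /andP[Hlow Hup] := Hk x a c z xacz.
have ME : (max_abs a c z)%:~R ^ (- n%:Z - 1)
    = (sup_norm (a%:~R : R) c%:~R z%:~R ^+ n.+1)^-1.
  rewrite (_ : - n%:Z - 1 = - (n.+1)%:Z); last by rewrite -addn1 PoszD opprD.
  rewrite -exprnN /sup_norm -!intr_norm /max_abs.
  congr (_ ^- _).
  by rewrite !intr_max.
have /andP[wlow wup] : (sup_norm (a%:~R : R) c%:~R z%:~R ^+ n.+1)^-1
    <= omega_infty n (a%:~R : R) c%:~R z%:~R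
    <= 4 * (sup_norm (a%:~R : R) c%:~R z%:~R ^+ n.+1)^-1.
  apply: omega_infty_bounds => -[/eqP]; rewrite intr_eq0 => /eqP a0 /eqP.
  by rewrite intr_eq0 => /eqP c0; exact: ac0.
move: Hlow Hup; rewrite ME; set N := (_ ^-1) in wlow wup * => Hlow Hup.
rewrite /frak_c -/t; apply/andP; split.
  rewrite -mulrA ler_pM2l // mulrC ler_pdivrMr //; apply: le_trans Hup _.
  by rewrite mulrC ler_pM2r.
rewrite (_ : 4 * t / k1 * H x = t * (4 * (H x / k1))); last first.
  by field; rewrite gt_eqF.
rewrite ler_pM2l //; apply: le_trans wup _.
by rewrite ler_pM2l // ler_pdivlMr // mulrC.
Qed.
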